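(* Let $q\ge 2$ be a real number and $n\in\mathbb{N}_0$. Let $\mathcal{Q}_q$ be the distribution on $\mathbb{N}_0$ with mass function $$p_k=\frac{\prod_{i\ge 1,\ i\ \mathrm{odd}}(1-1/q^i)}{\prod_{i=1}^k(q^i-1)},\qquad k\in\mathbb{N}_0,$$ and let $\mathcal{Q}_{q,n}$ be the distribution on $\{0,\dots,n\}$ with mass function $p_{k,n}=N(n,n-k)/q^{\binom{n+1}{2}}$, where $$N(n,2h)=\prod_{i=1}^h\frac{q^{2i}}{q^{2i}-1}\prod_{i=0}^{2h-1}(q^{n-i}-1)\ \ (2h\le n),\qquad N(n,2h+1)=\prod_{i=1}^h\frac{q^{2i}}{q^{2i}-1}\prod_{i=0}^{2h}(q^{n-i}-1)\ \ (2h+1\le n).$$ If $n$ is even, then $$\frac{0.18}{q^{n+1}}\le\|\mathcal{Q}_{q,n}-\mathcal{Q}_q\|_{\mathrm{TV}}\le\frac{2.25}{q^{n+1}} .$$ If $n$ is odd, then $$\frac{0.18}{q^{n+2}}\le\|\mathcal{Q}_{q,n}-\mathcal{Q}_q\|_{\mathrm{TV}}\le\frac{2}{q^{n+2}} .$$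
   Context: $\mathbb{N}_0=\{0,1,2,\dots\}$. Empty products equal $1$. For probability distributions $P_1,P_2$ on a countable set $S$, $\|P_1-P_2\|_{\mathrm{TV}}=\frac12\sum_{s\in S}|P_1(s)-P_2(s)|$; a distribution on $\{0,\dots,n\}$ is regarded as a distribution on $\mathbb{N}_0$. For $q$ a prime power, $N(n,r)$ is the number of symmetric $n\times n$ matrices of rank $r$ over $\mathbb{F}_q$, so $\mathcal{Q}_{q,n}$ is the law of $n$ minus the rank of a uniformly random symmetric $n\times n$ matrix over $\mathbb{F}_q$. *)

(* Defs.v *)
From HB Require Import structures.
From mathcomp Require Import all_boot all_order all_algebra.
From mathcomp Require Import all_classical all_reals all_analysis.

Set Implicit Arguments.
Unset Strict Implicit.
Unset Printing Implicit Defensive.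

Import Order.TTheory GRing.Theory Num.Theory.
Import numFieldNormedType.Exports.

Local Open Scope classical_set_scope.
Local Open Scope ring_scope.

(* Distributions on the natural numbers are given by their mass functions.
   The value lies in \bar R so that the sum of the nonnegative terms is
   meaningful without any summability side condition. *)
Definition tv_dist (R : realType) (P1 P2 : nat -> R) : \bar R :=
  ((2^-1)%:E * \sum_(0 <= k <oo) `|P1 k - P2 k|%:E)%E.

Definition odd_prod (R : realType) (q : R) : R :=
  limn (fun m : nat => \prod_(1 <= i < m | odd i) (1 - 1 / q ^+ i)).

Definition Qlim (R : realType) (q : R) (k : nat) : R :=
  odd_prod q / \prod_(1 <= i < k.+1) (q ^+ i - 1).

(* For r = 2h and for r = 2h+1 alike, h = r./2 and the second product has
   exactly r factors.  The formula is meant for r <= n, where the truncated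
   subtraction n - i (i < r) is the true one. *)
Definition Nsym (R : realType) (q : R) (n r : nat) : R :=
  (\prod_(1 <= i < (r./2).+1) (q ^+ (2 * i) / (q ^+ (2 * i) - 1))) *
  \prod_(0 <= i < r) (q ^+ (n - i) - 1).

Definition Qfin (R : realType) (q : R) (n k : nat) : R :=
  if (k <= n)%N then Nsym q n (n - k) / q ^+ 'C(n.+1, 2) else 0.

(* Main.v *)
Require Import Defs.
From HB Require Import structures.
From mathcomp Require Import all_boot all_order all_algebra.
From mathcomp Require Import all_classical all_reals all_analysis.
From mathcomp Require Import zify ring lra.

Import Order.TTheory GRing.Theory Num.Theory.
Import numFieldNormedType.Exports.

(** Put [x = 1/q], let [O] be the infinite product of [1 - x^i] over odd [i],
    [E] its part with [i <= n], and [w_k] the reciprocal of the product of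
    [q^i - 1] over [1 <= i <= k].  The limit law is [p_k = O w_k].  Completing
    the product of the [q^(n-i) - 1] in the matrix count to a product over all
    [j <= n], and splitting the resulting factors [1 - x^j] by parity, gives
    [p_(k,n) = E A_k w_k], where [A_k] is the product of [1 - x^(2i)] over
    [(n-k)/2 < i <= n/2], both quotients rounded down ([Qfin_weight]);
    for [k > n] put [A_k = 0].

    Let [s] be the least odd number exceeding [n], that is [n+1] for even [n]
    and [n+2] for odd [n].  It is written [(2 * uphalf n).+1] below.
    Products of factors [1 - z_i] with [z_i] decaying at least like [4^-i] are
    controlled by their first factor ([prod_1B_ge]), so that
    [E (1 - 4/3 x^s) <= O <= E (1 - x^s)].

    - If [k <= 1] and [n - k] has the same half as [n], i.e. [k = 0], or
      [k = 1] with [n] odd, then [A_k = 1] and the difference of the masses is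
      [(E - O) w_k], which is of exact order [x^s] ([mass_diff_head]).
    - For every other [k], [E A_k <= O], and the difference is at most
      [O (1 - A_k) w_k], where [1 - A_k] is at most [4/3 x^s q^k], with an
      additional factor [q] for odd [n] ([mass_diff_tail]).  Since [w_k]
      decays like [q^(-k(k+1)/2)], the terms [w_k q^k] decrease geometrically
      from [k = 2] on, and the sum over [k] still has order [x^s].

    The upper bounds follow by adding these estimates, the quotients of [O] and
    [E] by [1 - x] being at most [1] whenever they occur.  For the lower bounds
    the term [k = 0] is enough: half of it is at least [O x^s / 2], and
    [O / 2 >= 5/24 > 0.18]. *)

Set Implicit Arguments.
Unset Strict Implicit.
Unset Printing Implicit Defensive.

Local Open Scope ring_scope.

(** * Products with rapidly decreasing factors *)

(** A Weierstrass product inequality: the product is at least [1] minus the sum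
    of the [z i], and that sum is at most the geometric series
    [z a (1 + 1/4 + 1/16 + ...) = 4/3 z a]. *)
Lemma prod_1B_ge (R : realFieldType) (z : nat -> R) (a b : nat)
    (z0 : forall i, 0 <= z i) (z1 : forall i, z i <= 1)
    (z4 : forall i, z i.+1 <= z i / 4) :
  1 - 4 / 3 * z a <= \prod_(a <= i < b) (1 - z i).
Proof.
have [m] := ubnP (b - a); elim: m a => // m IH a bam.
have [ba|ab] := leqP b a; first by rewrite big_geq //; have := z0 a; lra.
(* The induction step is (1 - u) (1 - 4/3 v) >= 1 - 4/3 u for v <= u / 4. *)
rewrite big_ltn //.
have /IH : (b - a.+1 < m)%N by lia.
have := z0 a; have := z1 a; have := z4 a; have := z0 a.+1.
set p := \prod_(_ <= _ < _) _; set u := z a; set v := z a.+1.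
move=> v0 vu u1 u0 hp.
have : 0 <= (1 - u) * (p - (1 - 4 / 3 * v)) by apply: mulr_ge0; lra.
have : 0 <= u * v by exact: mulr_ge0.
lra.
Qed.

Lemma prod_1B_le1 (R : realFieldType) (z : nat -> R) (a b : nat)
    (z0 : forall i, 0 <= z i) (z1 : forall i, z i <= 1) :
  \prod_(a <= i < b) (1 - z i) <= 1.
Proof. by apply: prodr_ile1 => i; have := z0 i; have := z1 i; lra. Qed.

(** * The odd and even factors, and the infinite odd product *)

Definition oddfac (R : realFieldType) (x : R) (h : nat) : R :=
  \prod_(0 <= i < h) (1 - x ^+ (2 * i).+1).

Definition evenfac (R : realFieldType) (x : R) (a b : nat) : R :=
  \prod_(a <= i < b) (1 - x ^+ (2 * i).+2).

Definition weight (R : realFieldType) (q : R) (k : nat) : R :=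
  (\prod_(1 <= i < k.+1) (q ^+ i - 1))^-1.

(** There are [uphalf n] odd numbers up to [n]. *)
Lemma oddfac_prod (R : realFieldType) (x : R) (n : nat) :
  \prod_(1 <= i < n.+1 | odd i) (1 - x ^+ i) = oddfac x (uphalf n).
Proof.
elim: n => [|n IH]; first by rewrite /oddfac !big_geq.
rewrite big_mkcond big_nat_recr //= -big_mkcond {}IH /oddfac.
rewrite uphalf_half; case: (boolP (odd n)) => [on|en].
  by rewrite mulr1 add1n.
rewrite add0n big_nat_recr //=; congr (_ * (1 - _ ^+ _)).
by rewrite mul2n even_halfK.
Qed.

Lemma prod_1BX (R : realFieldType) (x : R) (n : nat) :
  \prod_(1 <= i < n.+1) (1 - x ^+ i) = oddfac x (uphalf n) * evenfac x 0 n./2.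
Proof.
elim: n => [|n IH]; first by rewrite /oddfac /evenfac !big_geq // mulr1.
rewrite big_nat_recr //= {}IH /oddfac /evenfac uphalf_half.
case: (boolP (odd n)) => on.
  rewrite add1n [in RHS](big_nat_recr n./2 0 (fun i => 1 - x ^+ (2 * i).+2)) //=.
  rewrite mulrA; congr (_ * (1 - _ ^+ _)).
  by rewrite mul2n; lia.
rewrite add0n big_nat_recr //= mulrAC; congr (_ * (1 - _ ^+ _) * _).
by rewrite mul2n even_halfK.
Qed.

Lemma Qlim_weight (R : realType) (q : R) (k : nat) :
  Qlim q k = odd_prod q * weight q k.
Proof. by []. Qed.

Lemma invq_bounds (R : realFieldType) (q : R) (hq : 2 <= q) :
  0 < q^-1 /\ q^-1 <= 1 / 2.
Proof.
split; first by rewrite invr_gt0; lra.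
by rewrite div1r lef_pV2 // posrE; lra.
Qed.

Lemma evenfac_gt0 (R : realFieldType) (x : R) (x0 : 0 < x) (x1 : x <= 1 / 2)
    (a b : nat) : 0 < evenfac x a b.
Proof.
by apply: prodr_gt0 => i _; rewrite subr_gt0 exprn_ilt1 //; lra.
Qed.

(** The exponent ['C(n.+1, 2)] is [1 + 2 + ... + n]; this cancels the
    normalisation by the number of symmetric matrices. *)
Lemma prod_qX_sub1 (R : realFieldType) (q : R) (n : nat) (hq : 2 <= q) :
  \prod_(1 <= i < n.+1) (q ^+ i - 1) =
  q ^+ 'C(n.+1, 2) * \prod_(1 <= i < n.+1) (1 - q^-1 ^+ i).
Proof.
have q0 : q != 0 by lra.
elim: n => [|n IH]; first by rewrite !big_geq // expr0 mulr1.
rewrite big_nat_recr //= [in RHS]big_nat_recr //= IH (binS n.+1) bin1 exprD.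
set p := \prod_(_ <= _ < _) _; rewrite exprVn.
have := expf_neq0 n.+1 q0; set t := q ^+ n.+1 => t0.
by rewrite -!mulrA; congr (_ * _); rewrite [RHS]mulrCA [t * _]mulrBr mulr1 divff.
Qed.

(** The closed form of the finite mass function: it has the same [k]-dependent
    factor [weight q k] as the limit law, so that comparing the two laws amounts
    to comparing products of factors [1 - x^i]. *)
Lemma Qfin_weight (R : realType) (q : R) (n k : nat) (hq : 2 <= q) : (k <= n)%N ->
  Qfin q n k =
  oddfac q^-1 (uphalf n) * evenfac q^-1 (n - k)./2 n./2 * weight q k.
Proof.
move=> kn; rewrite /Qfin kn /Nsym.
have q0 : q != 0 by lra.
have [x0 x1] := invq_bounds hq; set x := q^-1 in x0 x1 *.
have pq i : (0 < i)%N -> q ^+ i - 1 != 0.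
  by move=> i0; rewrite subr_eq0 gt_eqF // exprn_egt1; lra || lia.
have -> : \prod_(1 <= i < (n - k)./2.+1) (q ^+ (2 * i) / (q ^+ (2 * i) - 1))
    = (evenfac x 0 (n - k)./2)^-1.
  rewrite /evenfac -prodfV big_add1 /=; apply: eq_bigr => i _.
  rewrite (_ : 2 * i.+1 = (2 * i).+2)%N; last by lia.
  rewrite exprVn; have := @pq (2 * i).+2 isT.
  have := expf_neq0 (2 * i).+2 q0; set t := q ^+ _ => t0 t1.
  by field; rewrite t0.
have -> : \prod_(0 <= i < n - k) (q ^+ (n - i) - 1)
    = weight q k * \prod_(1 <= i < n.+1) (q ^+ i - 1).
  rewrite (@big_cat_nat _ _ _ k.+1 1 n.+1) //= /weight mulKf; last first.
    by rewrite prodf_seq_neq0; apply/allP => i; rewrite mem_index_iota => /andP[/pq].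
  rewrite big_nat_rev /= add0n -[k.+1 in RHS]add0n big_addn subSS.
  rewrite [RHS]big_nat_cond [LHS]big_nat_cond.
  apply: eq_bigr => i /andP[/andP[_ ik] _].
  by congr (_ ^+ _ - 1); lia.
rewrite prod_qX_sub1 // prod_1BX.
have -> : evenfac x 0 n./2 = evenfac x 0 (n - k)./2 * evenfac x (n - k)./2 n./2.
  by rewrite /evenfac -big_cat_nat //= half_leq // leq_subr.
have := lt0r_neq0 (evenfac_gt0 x0 x1 0 (n - k)./2); have := expf_neq0 'C(n.+1, 2) q0.
by move=> ? ?; field; apply/andP.
Qed.

Lemma oddX_bounds (R : realFieldType) (x : R) (x0 : 0 < x) (x1 : x <= 1 / 2)
    (i : nat) : 0 <= x ^+ (2 * i).+1 /\ x ^+ (2 * i).+1 <= 1.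
Proof.
split; first by rewrite exprn_ge0 ?(ltW x0).
by rewrite exprn_ile1 ?(ltW x0) //; lra.
Qed.

Lemma exprX_le_quarter (R : realFieldType) (x : R) (x0 : 0 < x) (x1 : x <= 1 / 2)
    (i j : nat) :
  (i.+2 <= j)%N -> x ^+ j <= x ^+ i / 4.
Proof.
move=> ij; apply: (@le_trans _ _ (x ^+ i.+2)); first by apply: ler_wiXn2l => //; lra.
rewrite -addn2 exprD ler_wpM2l ?exprn_ge0 ?(ltW x0) //.
have : 0 <= (1 / 2 - x) * (1 / 2 + x) by apply: mulr_ge0; lra.
by rewrite expr2; lra.
Qed.

Lemma oddfac_gt0 (R : realFieldType) (x : R) (x0 : 0 < x) (x1 : x <= 1 / 2)
    (h : nat) : 0 < oddfac x h.
Proof.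
by apply: prodr_gt0 => i _; rewrite subr_gt0 exprn_ilt1 //; lra.
Qed.

Lemma oddfac_le (R : realFieldType) (x : R) (x0 : 0 < x) (x1 : x <= 1 / 2)
    (h m : nat) : (h <= m)%N ->
  oddfac x h * (1 - 4 / 3 * x ^+ (2 * h).+1) <= oddfac x m <= oddfac x h.
Proof.
move=> hm.
have -> : oddfac x m = oddfac x h * \prod_(h <= i < m) (1 - x ^+ (2 * i).+1).
  by rewrite /oddfac -big_cat_nat.
rewrite -[X in _ <= _ <= X]mulr1 !ler_pM2l ?oddfac_gt0 //.
apply/andP; split; last first.
  by apply: (@prod_1B_le1 _ (fun i => x ^+ (2 * i).+1)) => i;
    have [] := oddX_bounds x0 x1 i.
apply: (@prod_1B_ge _ (fun i => x ^+ (2 * i).+1)) => i;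
  try by have [] := oddX_bounds x0 x1 i.
by apply: exprX_le_quarter; lia.
Qed.

(** Both bounds hold for every partial product with at least [h] factors, with
    constants that do not depend on the number of factors, hence for the
    limit. *)
Lemma odd_prod_bounds (R : realType) (q : R) (hq : 2 <= q) (h : nat) :
  oddfac q^-1 h * (1 - 4 / 3 * q^-1 ^+ (2 * h).+1) <= odd_prod q <=
    oddfac q^-1 h.
Proof.
have [x0 x1] := invq_bounds hq; set x := q^-1 in x0 x1 *.
rewrite /odd_prod; set u := (u in limn u).
have uE m : u m = oddfac x (m./2).
  rewrite /u; case: m => [|m]; first by rewrite /oddfac !big_geq.
  rewrite -uphalfE -oddfac_prod.
  by apply: eq_bigr => i _; rewrite div1r exprVn.
have u_ni : {homo u : n m / (n <= m)%N >-> m <= n}.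
  by move=> n m nm; rewrite !uE; have /andP[] := oddfac_le x0 x1 (half_leq nm).
have u_lb : has_lbound (range u).
  by exists 0 => _ [m _ <-]; rewrite uE ltW // oddfac_gt0.
have u_cv : cvgn u by exact: nonincreasing_is_cvgn.
apply/andP; split; last first.
  have := nonincreasing_cvgn_ge u_ni u_cv h.*2.
  by rewrite uE doubleK.
apply: limr_ge => //; exists h.*2 => // m /= hm; rewrite uE.
have /(oddfac_le x0 x1)/andP[//] : (h <= m./2)%N by lia.
Qed.

Lemma oddfac_le1 (R : realFieldType) (x : R) (x0 : 0 < x) (x1 : x <= 1 / 2)
    (h : nat) : oddfac x h <= 1.
Proof.
by have /andP[_] := oddfac_le x0 x1 (leq0n h); rewrite {2}/oddfac big_geq.
Qed.

(** * Bounds on the even factors and on the weights *)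

Lemma evenX_bounds (R : realFieldType) (x : R) (x0 : 0 < x) (x1 : x <= 1 / 2)
    (i : nat) : 0 <= x ^+ (2 * i).+2 /\ x ^+ (2 * i).+2 <= 1.
Proof.
split; first by rewrite exprn_ge0 ?(ltW x0).
by rewrite exprn_ile1 ?(ltW x0) //; lra.
Qed.

Lemma evenfac_ge (R : realFieldType) (x : R) (x0 : 0 < x) (x1 : x <= 1 / 2)
    (a b : nat) : 1 - 4 / 3 * x ^+ (2 * a).+2 <= evenfac x a b.
Proof.
apply: (@prod_1B_ge _ (fun i => x ^+ (2 * i).+2)) => i;
  try by have [] := evenX_bounds x0 x1 i.
by apply: exprX_le_quarter => //; lia.
Qed.

Lemma evenfac_le1 (R : realFieldType) (x : R) (x0 : 0 < x) (x1 : x <= 1 / 2)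
    (a b : nat) : evenfac x a b <= 1.
Proof.
by apply: (@prod_1B_le1 _ (fun i => x ^+ (2 * i).+2)) => i;
  have [] := evenX_bounds x0 x1 i.
Qed.

(** The last factor alone gives this bound.  It ensures that a nonempty product
    of even factors outweighs the missing odd factors beyond [n]. *)
Lemma evenfac_le (R : realFieldType) (x : R) (x0 : 0 < x) (x1 : x <= 1 / 2)
    (a b : nat) : (a < b)%N -> evenfac x a b <= 1 - x ^+ (2 * b).
Proof.
case: b => // b ab; rewrite /evenfac big_nat_recr //=.
rewrite (_ : 2 * b.+1 = (2 * b).+2)%N; last by lia.
rewrite -[X in _ <= X]mul1r ler_wpM2r //; last exact: evenfac_le1.
by have [] := evenX_bounds x0 x1 b; lra.
Qed.

Lemma weight_gt0 (R : realFieldType) (q : R) (k : nat) (hq : 2 <= q) :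
  0 < weight q k.
Proof.
rewrite invr_gt0 big_add1 /=; apply: prodr_gt0 => i _.
by rewrite subr_gt0 exprn_egt1 //; lra.
Qed.

Lemma weightS (R : realFieldType) (q : R) (k : nat) :
  weight q k.+1 = weight q k / (q ^+ k.+1 - 1).
Proof. by rewrite /weight big_nat_recr //= invfM. Qed.

Lemma weight0 (R : realFieldType) (q : R) : weight q 0 = 1.
Proof. by rewrite /weight big_geq // invr1. Qed.

(** Consecutive terms [weight q k * q ^+ k] have ratio [q / (q ^+ k.+1 - 1)]; for
    [k >= 2] it is largest at [k = 2] and [q = 2], with value [2 / 7]. *)
Lemma weight_powS (R : realFieldType) (q : R) (k : nat) (hq : 2 <= q) :
  (2 <= k)%N ->
  weight q k.+1 * q ^+ k.+1 <= 2 / 7 * (weight q k * q ^+ k).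
Proof.
move=> k2; rewrite weightS exprSr.
have w0 := weight_gt0 k hq.
have qk0 : 0 < q ^+ k by rewrite exprn_gt0; lra.
have q2 : 4 <= q ^+ 2 by rewrite expr2; have := ler_pM _ _ hq hq; lra.
have qk : q ^+ 2 <= q ^+ k by apply: ler_weXn2l => //; lra.
set w := weight q k in w0 *; set s := q ^+ k in qk0 qk *.
have sq : 8 <= s * q by have := ler_pM _ _ (le_trans q2 qk) hq; lra.
rewrite (_ : w / (s * q - 1) * (s * q) = w * s * (q / (s * q - 1))); last by ring.
rewrite mulrC ler_wpM2r //; first by apply: mulr_ge0; lra.
rewrite ler_pdivrMr; last by lra.
have : 0 <= (s - 4) * q by apply: mulr_ge0; lra.
lra.
Qed.

(** * Partial sums and the total variation distance *)

(** The first two terms are kept apart because they do not fit the geometric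
    decay; [7 / 5] is the sum of the series with ratio [2 / 7]. *)
Lemma sum_geom_tail_le (R : realFieldType) (d : nat -> R) (M : R)
    (d0 : forall k, 0 <= d k) (M0 : 0 <= M)
    (dM : forall k, d k.+2 <= M * (2 / 7) ^+ k) (N : nat) :
  \sum_(0 <= k < N) d k <= d 0%N + d 1%N + 7 / 5 * M.
Proof.
have H m : \sum_(0 <= k < m.+2) d k <=
    d 0%N + d 1%N + 7 / 5 * M * (1 - (2 / 7) ^+ m).
  elim: m => [|m IH]; first by rewrite !big_nat_recr //= big_geq //; lra.
  rewrite big_nat_recr //= exprS; have := dM m; move: IH.
  by set y := (2 / 7) ^+ m; set S := \sum_(_ <= _ < _) _; nra.
apply: (@le_trans _ _ (\sum_(0 <= k < N.+2) d k)).
  by rewrite big_nat_recr //= big_nat_recr //=; have := d0 N; have := d0 N.+1; lra.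
by apply: le_trans (H N) _; rewrite lerD2l ler_piMr //; lra.
Qed.

Lemma tv_dist_le (R : realType) (P1 P2 : nat -> R) (C : R) :
  (forall N, \sum_(0 <= k < N) `|P1 k - P2 k| <= 2 * C) ->
  (tv_dist P1 P2 <= C%:E)%E.
Proof.
move=> hC; rewrite /tv_dist -lee_pdivlMl // invrK -EFinM.
apply: lime_le; first by apply: is_cvg_nneseries => k _ _; rewrite lee_fin.
by apply: nearW => N; rewrite sumEFin lee_fin.
Qed.

Lemma tv_dist_ge (R : realType) (P1 P2 : nat -> R) :
  ((`|P1 0%N - P2 0%N| / 2)%:E <= tv_dist P1 P2)%E.
Proof.
rewrite /tv_dist mulrC EFinM lee_pmul2l ?lte_fin ?invr_gt0 //.
have := @nneseries_lim_ge R (fun k => `|P1 k - P2 k|%:E) xpredT 0 1.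
by rewrite big_nat1; apply => k _ _; rewrite lee_fin.
Qed.

(** * Differences of the masses *)

Lemma half_sub_lt (n k : nat) : (odd n < k)%N -> (k <= n)%N ->
  ((n - k)./2 < n./2)%N.
Proof. lia. Qed.

(** The number [(2 * uphalf n).+1] is the least odd number greater than [n]. *)
Lemma rate_exp_half (n : nat) : ((2 * n./2).+1 <= (2 * uphalf n).+1)%N.
Proof. by rewrite uphalf_half; lia. Qed.

Lemma rate_exp_le (n k : nat) :
  ((2 * uphalf n).+1 <= (2 * (n - k)./2).+2 + (k + odd n))%N.
Proof. by rewrite uphalf_half; lia. Qed.

Lemma rate_exp_gt (n k : nat) : (n < k)%N ->
  ((2 * uphalf n).+1 <= k + odd n)%N.
Proof. by rewrite uphalf_half; lia. Qed.

(** Taking [h = 1] in [odd_prod_bounds] gives [(1 - x) (1 - 4/3 x^3)], which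
    decreases in [x] and is [5/12] at [x = 1/2]. *)
Lemma odd_prod_ge (R : realType) (q : R) (hq : 2 <= q) : 5 / 12 <= odd_prod q.
Proof.
have [x0 x1] := invq_bounds hq.
have /andP[+ _] := odd_prod_bounds hq 1.
apply: le_trans; rewrite /oddfac big_nat1 muln0 muln1 expr1.
set x := q^-1 in x0 x1 *.
have x3 : x ^+ 3 <= 1 / 8.
  have x2 : x * x <= 1 / 4 by have := @ler_pM _ x _ x _ (ltW x0) (ltW x0) x1 x1; lra.
  have x20 : 0 <= x * x by rewrite mulr_ge0 ?ltW.
  by rewrite exprS expr2; have := ler_pM (ltW x0) x20 x1 x2; lra.
have : 0 <= (1 / 2 - x) * (1 - 4 / 3 * x ^+ 3) by apply: mulr_ge0; lra.
lra.
Qed.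

(** Here [(n - k)./2 = n./2], so no even factor is left and the difference is
    [weight q k] times [E - O].  The lower bound comes from the first odd factor
    beyond [n], which is a factor of [O] but not of [E]. *)
Lemma mass_diff_head (R : realType) (q : R) (n k : nat) (hq : 2 <= q) :
  (k <= n)%N -> (k <= odd n)%N ->
  odd_prod q * q^-1 ^+ (2 * uphalf n).+1 * weight q k <=
    `|Qfin q n k - Qlim q k| <=
  4 / 3 * oddfac q^-1 (uphalf n) * q^-1 ^+ (2 * uphalf n).+1 * weight q k.
Proof.
move=> kn kodd; have [x0 x1] := invq_bounds hq.
rewrite Qfin_weight // Qlim_weight /evenfac big_geq; last by lia.
have w0 := weight_gt0 k hq.
have /andP[lo hi] := odd_prod_bounds hq (uphalf n).
have /andP[_ hi'] := odd_prod_bounds hq (uphalf n).+1.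
have t0 : 0 <= q^-1 ^+ (2 * uphalf n).+1 by rewrite exprn_ge0 ?(ltW x0).
move: hi'; rewrite {1}/oddfac big_nat_recr //= -/(oddfac _ _).
move: lo hi t0; set o := odd_prod q; set t := _ ^+ _; set e := oddfac _ _.
move=> lo hi t0 hi'.
rewrite mulr1 -mulrBl normrM (gtr0_norm w0) ger0_norm; last by lra.
rewrite !ler_pM2r //.
have : 0 <= (e - o) * t by apply: mulr_ge0; lra.
by move=> ?; apply/andP; split; lra.
Qed.

(** At least one even factor is now present, namely that of exponent
    [2 * n./2 < (2 * uphalf n).+1].  It makes the finite mass the smaller one, and
    then [E] may be replaced by the smaller [O] to bound the difference by
    [O (1 - A) weight q k].  For [k > n] the finite mass vanishes and the factor
    [x^s q^(k + odd n)] is at least [1]. *)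
Lemma mass_diff_tail (R : realType) (q : R) (n k : nat) (hq : 2 <= q) :
  (odd n < k)%N ->
  `|Qfin q n k - Qlim q k| <=
  4 / 3 * q^-1 ^+ (2 * uphalf n).+1 *
    (odd_prod q * weight q k * q ^+ (k + odd n)).
Proof.
move=> kodd; have [x0 x1] := invq_bounds hq.
have q0 : q != 0 by lra.
have w0 := weight_gt0 k hq.
have o0 := odd_prod_ge hq.
have /andP[lo hi] := odd_prod_bounds hq (uphalf n).
have e0 := oddfac_gt0 x0 x1 (uphalf n).
set x := q^-1 in x0 x1 lo hi e0 *.
have qx m : q ^+ m = (x ^+ m)^-1 by rewrite exprVn invrK.
have xp m : 0 < x ^+ m by rewrite exprn_gt0.
have [kn|nk] := leqP k n; last first.
  rewrite /Qfin leqNgt nk /= sub0r normrN Qlim_weight.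
  rewrite ger0_norm; last by rewrite mulr_ge0 ?(ltW w0) //; lra.
  rewrite mulrC -mulrA mulrC.
  set ow := odd_prod q * _; have ow0 : 0 < ow by rewrite mulr_gt0 //; lra.
  rewrite [X in _ <= X](_ : _ =
    ow * (4 / 3 * (x ^+ (2 * uphalf n).+1 * q ^+ (k + odd n)))); last by ring.
  rewrite -[X in X <= _]mulr1 ler_pM2l // qx.
  suff : 1 <= x ^+ (2 * uphalf n).+1 / x ^+ (k + odd n) by lra.
  rewrite ler_pdivlMr // mul1r; apply: ler_wiXn2l; [lra|lra|].
  exact: rate_exp_gt.
rewrite Qfin_weight // Qlim_weight -/x.
have hh := half_sub_lt kodd kn.
have A0 := evenfac_gt0 x0 x1 (n - k)./2 n./2.
have Ale := evenfac_le x0 x1 hh.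
have Age := evenfac_ge x0 x1 (n - k)./2 n./2.
set A := evenfac _ _ _ in A0 Ale Age *.
set e := oddfac _ _ in lo hi e0 *.
have t_le : x ^+ (2 * uphalf n).+1 <= x ^+ (2 * n./2) / 2.
  apply: (@le_trans _ _ (x ^+ (2 * n./2).+1)).
    by apply: ler_wiXn2l; [lra|lra|exact: rate_exp_half].
  by rewrite exprSr; apply: ler_wpM2l; [exact: ltW|lra].
have A1 : A <= 1 by have := xp (2 * n./2)%N; lra.
have eA : e * A <= odd_prod q.
  apply: le_trans lo; rewrite ler_pM2l //.
  by have := xp (2 * n./2)%N; lra.
rewrite -mulrBl normrM (gtr0_norm w0) ler0_norm; last by lra.
rewrite [X in _ <= X](_ : _ = odd_prod q * (4 / 3 *
  (x ^+ (2 * uphalf n).+1 * q ^+ (k + odd n))) * weight q k); last by ring.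
rewrite ler_pM2r // opprB.
apply: (@le_trans _ _ (odd_prod q * (1 - A))).
  have eoA : 0 <= (e - odd_prod q) * A by apply: mulr_ge0; lra.
  lra.
rewrite ler_pM2l; last by lra.
suff : x ^+ (2 * (n - k)./2).+2 <= x ^+ (2 * uphalf n).+1 * q ^+ (k + odd n).
  by lra.
rewrite qx ler_pdivlMr // -exprD; apply: ler_wiXn2l; [lra|lra|].
exact: rate_exp_le.
Qed.

(** The left side is [O / (1 - x)], which is the product of the odd factors from
    [1 - x^3] on. *)
Lemma odd_prod_weight1_le (R : realType) (q : R) (hq : 2 <= q) :
  odd_prod q * weight q 1 * q <= 1.
Proof.
have /andP[_ hi] := odd_prod_bounds hq 1.
rewrite weightS weight0 expr1 mul1r mulrAC ler_pdivrMr; last by lra.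
rewrite mul1r; move: hi; rewrite /oddfac big_nat1 muln0 expr1 => hi.
have := ler_wpM2r (_ : 0 <= q) hi; rewrite mulrBl mul1r mulVf; last by lra.
by apply; lra.
Qed.

Lemma weight_pow_geom (R : realFieldType) (q : R) (k : nat) (hq : 2 <= q) :
  weight q k.+2 * q ^+ k.+2 <= weight q 2 * q ^+ 2 * (2 / 7) ^+ k.
Proof.
elim: k => [|k IH]; first by rewrite expr0 mulr1.
have := weight_powS hq (isT : (2 <= k.+2)%N).
by rewrite [_ ^+ k.+1]exprS; lra.
Qed.

(** At [k = 0] the left side is [O / (1 - x)] times [q / (q ^+ 2 - 1)], and every
    further step costs a factor [2 / 7]. *)
Lemma odd_prod_tail (R : realType) (q : R) (k : nat) (hq : 2 <= q) :
  odd_prod q * weight q k.+2 * q ^+ k.+2 <= q / (q ^+ 2 - 1) * (2 / 7) ^+ k.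
Proof.
have h1 := odd_prod_weight1_le hq.
have o0 := odd_prod_ge hq.
have h2 := weight_pow_geom k hq.
have r0 : 0 <= (2 / 7 : R) ^+ k by rewrite exprn_ge0 //; lra.
have q2 : 4 <= q ^+ 2 by rewrite expr2; have := ler_pM _ _ hq hq; lra.
apply: (@le_trans _ _ (odd_prod q * (weight q 2 * q ^+ 2 * (2 / 7) ^+ k))).
  by rewrite -mulrA ler_pM2l //; lra.
rewrite mulrA ler_wpM2r // weightS.
rewrite (_ : _ * _ = (odd_prod q * weight q 1 * q) * (q / (q ^+ 2 - 1))); last first.
  by rewrite expr2; ring.
by rewrite ler_piMl // divr_ge0 //; lra.
Qed.

(** * Upper bounds *)

(** In units of [4/3 x^s], the terms [k = 0] and [k = 1] contribute at most [1]
    each, and the others at most [7/5 * 2/3], since [q / (q^2 - 1) <= 2/3]; the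
    total [4/3 * 44/15] is below [9/2]. *)
Lemma sum_mass_diff_even (R : realType) (q : R) (n N : nat) (hq : 2 <= q) :
  ~~ odd n ->
  \sum_(0 <= k < N) `|Qfin q n k - Qlim q k| <=
    9 / 2 * q^-1 ^+ (2 * uphalf n).+1.
Proof.
move=> en; have [x0 x1] := invq_bounds hq.
have /andP[_ d0] := @mass_diff_head R q n 0 hq isT isT.
have := @mass_diff_tail R q n 1 hq; rewrite (negbTE en) addn0 expr1 => /(_ isT) d1.
have dk k := @mass_diff_tail R q n k.+2 hq.
move: d0 d1 dk; rewrite (negbTE en); set t := _ ^+ (2 * _).+1.
have t0 : 0 < t by rewrite exprn_gt0.
rewrite weight0 => d0 d1 dk.
have e1 := oddfac_le1 x0 x1 (uphalf n).
have o1 := odd_prod_weight1_le hq.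
apply: le_trans (@sum_geom_tail_le _ _ (4 / 3 * t * (2 / 3)) _ _ _ N) _ => //.
- by rewrite !mulr_ge0 //; lra.
- move=> k; apply: le_trans (dk k isT) _.
  rewrite addn0 -[X in _ <= X]mulrA ler_pM2l; last by lra.
  apply: le_trans (odd_prod_tail k hq) _; rewrite ler_wpM2r //.
  (* q / (q^2 - 1) <= 2/3 amounts to (q - 2) (q + 1/2) >= 0. *)
  have : 0 <= (q - 2) * (q + 1 / 2) by apply: mulr_ge0; lra.
  move=> hq2; rewrite ler_pdivrMr expr2; lra.
have : `|Qfin q n 0 - Qlim q 0| <= 4 / 3 * t.
  apply: le_trans d0 _.
  have : 0 <= (1 - oddfac q^-1 (uphalf n)) * t by apply: mulr_ge0; lra.
  lra.
have : `|Qfin q n 1 - Qlim q 1| <= 4 / 3 * t.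
  by apply: le_trans d1 _; rewrite ler_piMr //; lra.
lra.
Qed.

(** In units of [4/3 x^s], the terms [k = 0] and [k = 1] together contribute at
    most [E q / (q - 1) <= 1], since for odd [n] the factor [1 - 1/q] occurs in
    [E].  The others contribute at most [7/5 * 4/3], since
    [q^2 / (q^2 - 1) <= 4/3]; the total [4/3 * 43/15] is below [4]. *)
Lemma sum_mass_diff_odd (R : realType) (q : R) (n N : nat) (hq : 2 <= q) :
  odd n ->
  \sum_(0 <= k < N) `|Qfin q n k - Qlim q k| <=
    4 * q^-1 ^+ (2 * uphalf n).+1.
Proof.
move=> on; have [x0 x1] := invq_bounds hq.
have n0 : (0 < n)%N by case: n on.
have := @mass_diff_head R q n 0 hq isT; rewrite on => /(_ isT)/andP[_ d0].
have := @mass_diff_head R q n 1 hq n0; rewrite on => /(_ isT)/andP[_ d1].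
have dk k := @mass_diff_tail R q n k.+2 hq.
move: d0 d1 dk; rewrite on; set t := _ ^+ (2 * _).+1.
have t0 : 0 < t by rewrite exprn_gt0.
have h0 : (1 <= uphalf n)%N by rewrite uphalf_half on.
have /andP[_] := oddfac_le x0 x1 h0.
rewrite {2}/oddfac big_nat1 muln0 expr1 weightS weight0 expr1 mul1r.
set e := oddfac _ _ => e1 d0 d1 dk.
(* The sum of the weights at 0 and 1 is q / (q - 1), the inverse of 1 - 1/q. *)
have ew : e * (1 + (q - 1)^-1) <= 1.
  have -> : 1 + (q - 1)^-1 = q / (q - 1) by field; lra.
  rewrite mulrA ler_pdivrMr; last by lra.
  have := ler_wpM2r (_ : 0 <= q) e1; rewrite mulrBl mul1r mulVf; last by lra.
  by rewrite mul1r; apply; lra.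
apply: le_trans (@sum_geom_tail_le _ _ (4 / 3 * t * (4 / 3)) _ _ _ N) _ => //.
- by rewrite !mulr_ge0 //; lra.
- move=> k; apply: le_trans (dk k isT) _.
  rewrite -[X in _ <= X]mulrA ler_pM2l; last by lra.
  rewrite addn1 exprSr mulrA.
  apply: le_trans (ler_wpM2r _ (odd_prod_tail k hq)) _; first by lra.
  rewrite mulrAC ler_wpM2r //.
  have : 0 <= (q - 2) * (q + 2) by apply: mulr_ge0; lra.
  move=> hq2; rewrite mulrAC ler_pdivrMr expr2; lra.
have : 4 / 3 * t * (e * (1 + (q - 1)^-1)) <= 4 / 3 * t.
  by rewrite ler_piMr //; lra.
lra.
Qed.

(** * Lower bound and conclusion *)

(** The term at [k = 0] alone gives [1/2 * 5/12 = 5/24], which exceeds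
    [18 / 100]. *)
Lemma tv_dist_rate_ge (R : realType) (q : R) (n : nat) (hq : 2 <= q) :
  ((18 / 100 * q^-1 ^+ (2 * uphalf n).+1)%:E <= tv_dist (Qfin q n) (Qlim q))%E.
Proof.
have [x0 x1] := invq_bounds hq.
apply: le_trans (tv_dist_ge _ _); rewrite lee_fin.
have /andP[d0 _] := @mass_diff_head R q n 0 hq isT (leq0n _).
move: d0; rewrite weight0 mulr1; have o0 := odd_prod_ge hq.
set t := _ ^+ _; have t0 : 0 < t by rewrite exprn_gt0.
have : 0 <= (odd_prod q - 5 / 12) * t by apply: mulr_ge0; lra.
lra.
Qed.

Theorem theorem4p1 (R : realType) (q : R) (n : nat) (hq : 2 <= q) :
  (~~ odd n ->
     ((18 / 100 / q ^+ n.+1)%:E <= tv_dist (Qfin q n) (Qlim q))%E /\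
     (tv_dist (Qfin q n) (Qlim q) <= (225 / 100 / q ^+ n.+1)%:E)%E) /\
  (odd n ->
     ((18 / 100 / q ^+ n.+2)%:E <= tv_dist (Qfin q n) (Qlim q))%E /\
     (tv_dist (Qfin q n) (Qlim q) <= (2 / q ^+ n.+2)%:E)%E).
Proof.
have ge := tv_dist_rate_ge n hq.
split=> pn.
  have -> : n.+1 = (2 * uphalf n).+1 by rewrite uphalf_half (negbTE pn); lia.
  rewrite -exprVn; split=> //; apply: tv_dist_le => N.
  by apply: le_trans (sum_mass_diff_even N hq pn) _; rewrite mulrA; lra.
have -> : n.+2 = (2 * uphalf n).+1 by rewrite uphalf_half pn; lia.
rewrite -exprVn; split=> //; apply: tv_dist_le => N.
by apply: le_trans (sum_mass_diff_odd N hq pn) _; rewrite mulrA; lra.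
Qed.
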